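(* For all non-negative integers $L,t$, positive integers $p,p'$ such that $p' > p$, and any integer $n\ge 2$, \[ \begin{aligned} D_{3^t\cdot2^np',3^t\cdot2^ns}\Bigg(&L+3^t\cdot2^{n-2}+3^t\cdot2^{n-1}(r-s),\,L-3^t\cdot2^{n-2}-3^t\cdot2^{n-1}(r-s);\\ &\frac{\frac{2^{2n}-1}{3}(2p'-1)-\frac{2^{2n+1}+1}{3}r+p}{2^n}-(3^t-1)\cdot2^{n-2}+(3^t-1)\cdot2^{n-1}(p'-r),\\ &\frac{\frac{2^{2n+1}+1}{3}r+\frac{2^{2n}-1}{3}}{2^n}+(3^t-1)\cdot2^{n-2}+(3^t-1)\cdot2^{n-1}r\Bigg) \ge 0, \end{aligned} \] where $r$, $s$ are integers such that $0 < r < p$ and $0 < s < p'$.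
   Context: The $q$-binomial coefficient is $\begin{bmatrix}m\\ n\end{bmatrix}_q=\frac{(q;q)_m}{(q;q)_n(q;q)_{m-n}}$ for $m\ge n\ge 0$ and $0$ otherwise, where $(a;q)_L=\prod_{k=0}^{L-1}(1-aq^k)$. For integers $K,i$ and (possibly rational) parameters $N,M,\alpha,\beta$, \[ D_{K,i}(N,M;\alpha,\beta)=\sum_{j\in\mathbb{Z}}\left\{q^{j((\alpha+\beta)Kj+K\beta-(\alpha+\beta)i)}\begin{bmatrix}M+N\\ M-Kj\end{bmatrix}_{q}-q^{((\alpha+\beta)j+\beta)(Kj+i)}\begin{bmatrix}M+N\\ M-Kj-i\end{bmatrix}_{q}\right\}. \] ''$P(q)\ge 0$'' means the power series $P(q)$ has non-negative coefficients. *)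

(* Defs.v *)
From HB Require Import structures.
From mathcomp Require Import all_boot all_order all_algebra.
Set Implicit Arguments. Unset Strict Implicit. Unset Printing Implicit Defensive.
Import Order.TTheory GRing.Theory Num.Theory.
Local Open Scope ring_scope.

Definition qpoch (m : nat) : {poly rat} := \prod_(k < m) (1 - 'X^(k.+1)).

(* q-binomial coefficient [m n]_q = (q;q)_m / ((q;q)_n (q;q)_{m-n}) for
   m >= n >= 0 (exact polynomial division), and 0 otherwise. *)
Definition qbinom (m n : int) : {poly rat} :=
  if (0 <= n) && (n <= m)
  then qpoch `|m|%N %/ (qpoch `|n|%N * qpoch `|m - n|%N)
  else 0.

(* coefficient of q^e in q^a * P(q), for rational exponents e, a *)
Definition shift_coef (a : rat) (P : {poly rat}) (e : rat) : rat :=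
  if (e - a) \is a Num.nat then P`_(Num.truncn (e - a)) else 0.

(* Window of summation indices j.  For K <> 0 every j giving a nonzero
   q-binomial in D satisfies |K j| <= 2|M| + |N| + |i|, so summing over
   |j| <= B with B = 2|M|+|N|+|i|+1 gives exactly the sum over all j in Z. *)
Definition jwindow (K i N M : int) : seq int :=
  let B := (2 * `|M| + `|N| + `|i| + 1)%N in
  [seq (j%:Z - B%:Z) | j <- iota 0 (2 * B + 1)].

Definition Dcoef (K i N M : int) (alpha beta : rat) (e : rat) : rat :=
  \sum_(j <- jwindow K i N M)
    ( shift_coef ((j%:~R) * ((alpha + beta) * K%:~R * j%:~R + K%:~R * beta
                               - (alpha + beta) * i%:~R))
                 (qbinom (M + N) (M - K * j)) e
    - shift_coef (((alpha + beta) * j%:~R + beta) * (K%:~R * j%:~R + i%:~R))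
                 (qbinom (M + N) (M - K * j - i)) e ).

Definition Dnonneg (K i N M : int) (alpha beta : rat) : Prop :=
  forall e : rat, 0 <= Dcoef K i N M alpha beta e.

(* Main.v *)
Require Import Defs.
From HB Require Import structures.
From mathcomp Require Import all_boot all_order all_algebra.
From mathcomp Require Import ring lra zify.
Import Order.TTheory GRing.Theory Num.Theory.
Local Open Scope ring_scope.

(* The sum D_{p',s} with alpha = p - r, beta = r and N - M in {r - s, r - s + 1}
   is a generating function of partitions with prescribed hook differences
   (Andrews-Baxter-Bressoud-Burge-Forrester-Viennot), and it is positive because
   the two q-Pascal recurrences decrease M + N while preserving
   beta <= N - M + i <= K - alpha; where neither applies, the sum vanishes by
   reflection. From there one climbs with transformations whose kernels have
   non-negative coefficients:
     q^(a(a+1)/2) [2L+1, L-a] = sum_{r,k} q^(r(r+1)/2+k^2+k+kr)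
                                  [L,r] [L-r,k] [r, floor((r-a)/2)],
     q^(a^2/2) [2L, L-a] = sum_{r,k, r = a mod 2} q^(r^2/2+k^2+kr)
                                  [L,r] [L-r,k] [r, (r-a)/2],
     q^(3a^2) [2L, L-3a] = sum_r q^(3r^2) (1-q^(2L)) (q^3;q^3)_{L-r-1}
                             / ((q^3;q^3)_{2r} (q;q)_{L-3r}) [2r, r-a]_{q^3}.
   The first two are double q-Vandermonde sums, the third telescopes in r.
   One use of the first, n - 1 of the second and t of the third give the theorem.
   All of this takes place in a field F for a parameter q that is not a root of
   unity, positivity being membership in a semiring C containing q and 1/q; at the
   end F is the field of rational functions and C consists of the Laurent
   polynomials with non-negative coefficients. *)

(** * q-binomial coefficients *)

Section QBinomial.
Variables (F : fieldType) (q : F).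

Definition generic := q != 0 /\ forall n, q ^+ n.+1 != 1.
Definition qfact (m : nat) : F := \prod_(k < m) (1 - q ^+ k.+1).
(* Taking 1/(q;q)_n to be 0 for n < 0 makes 1/(q;q)_(n-1) = (1 - q^n)/(q;q)_n
   true for every integer n. *)
Definition iqfact (n : int) : F := if n is Posz k then (qfact k)^-1 else 0.
(* Locked: otherwise unification unfolds it to a product when rewriting with mulrA. *)
Fact qbin_key : unit. Proof. exact: tt. Qed.
Definition qbin (m : nat) (n : int) : F :=
  locked_with qbin_key (qfact m * iqfact n * iqfact (m%:Z - n)).

Lemma qbinE m n : qbin m n = qfact m * iqfact n * iqfact (m%:Z - n).
Proof. by rewrite /qbin unlock. Qed.


Hypothesis q_gen : generic.
Let q_neq0 : q != 0 := proj1 q_gen.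

Lemma qfactS m : qfact m.+1 = qfact m * (1 - q ^+ m.+1).
Proof. by rewrite /qfact big_ord_recr. Qed.

Lemma qfact0 : qfact 0 = 1.
Proof. by rewrite /qfact big_ord0. Qed.

Lemma qfact_neq0 m : qfact m != 0.
Proof.
apply/prodf_neq0 => k _; rewrite subr_eq0 eq_sym; exact: (proj2 q_gen).
Qed.

Lemma iqfact_lt0 n : n < 0 -> iqfact n = 0.
Proof. by case: n. Qed.

Lemma qfactK m : qfact m * iqfact m = 1.
Proof. by rewrite /= mulfV ?qfact_neq0. Qed.

Lemma iqfact_pred n : iqfact (n - 1) = (1 - q ^ n) * iqfact n.
Proof.
case: n => [[|n]|n].
- by rewrite expr0z subrr mul0r.
- have -> : Posz n.+1 - 1 = n by lia.
  rewrite /iqfact; have := qfact_neq0 n.+1; rewrite /= qfactS mulf_eq0 negb_or => /andP[h1 h2].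
  by rewrite -[q ^ n.+1]/(q ^+ n.+1); field; rewrite h1 h2.
- by rewrite !iqfact_lt0 ?mulr0 //; lia.
Qed.

Lemma expzD (m n : int) : q ^ (m + n) = q ^ m * q ^ n.
Proof. exact: expfzDr. Qed.

Lemma expzB (m n : int) : q ^ (m - n) = q ^ m / q ^ n.
Proof. by rewrite expzD -invr_expz. Qed.

Lemma expz_neq0 (n : int) : q ^ n != 0.
Proof. exact: expfz_neq0. Qed.

Lemma qbin_sym m n : qbin m n = qbin m (m%:Z - n).
Proof. by rewrite !qbinE mulrAC; congr (_ * iqfact _); lia. Qed.

Lemma qbin_lt0 m n : n < 0 -> qbin m n = 0.
Proof. by move=> h; rewrite !qbinE iqfact_lt0 // mulr0 mul0r. Qed.

Lemma qbin_gt m n : m%:Z < n -> qbin m n = 0.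
Proof. by move=> h; rewrite !qbinE (iqfact_lt0 (_ - _)) ?mulr0 //; lia. Qed.

Lemma qbin0 n : qbin 0 n = (n == 0)%:R.
Proof.
case: (ltrgtP n 0) => [h|h|->]; first by rewrite qbin_lt0.
  by rewrite qbin_gt.
by rewrite !qbinE /= qfact0 invr1 !mulr1.
Qed.

Lemma qbin_qfact m k : (k <= m)%N ->
  qbin m k * (qfact k * qfact (m - k)) = qfact m.
Proof.
move=> km; rewrite qbinE (_ : m%:Z - k%:Z = (m - k)%N); last lia.
by rewrite /iqfact; field; rewrite !qfact_neq0.
Qed.

Lemma qbinS m n : qbin m.+1 n = qbin m (n - 1) + q ^ n * qbin m n.
Proof.
rewrite !qbinE qfactS.
have -> : m%:Z - (n - 1) = m.+1%:Z - n by lia.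
have -> : m%:Z - n = m.+1%:Z - n - 1 by lia.
rewrite !iqfact_pred expzB -[q ^ m.+1]/(q ^+ m.+1).
by field; exact: expz_neq0.
Qed.

Lemma qbinS' m n :
  qbin m.+1 n = qbin m n + q ^ (m.+1%:Z - n) * qbin m (n - 1).
Proof.
rewrite qbin_sym qbinS [qbin m n]qbin_sym [qbin m (n - 1)]qbin_sym.
by congr (qbin _ _ + _ * qbin _ _); lia.
Qed.

(** Induction on [l]: q-Pascal in the first factor gives the instances at [a] and, after a shift of
    [m], at [a + 1]; the other q-Pascal rule recombines them. *)
Lemma qVandermonde (l l' N : nat) (a : int) : (l < N)%N ->
  \sum_(m < N) q ^ (m%:Z * (m%:Z + a)) * qbin l m * qbin l' (m%:Z + a)
  = qbin (l + l') (l%:Z + a).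
Proof.
elim: l N a => [|l IHl] [|N] a // lN.
  rewrite big_ord_recl big1 => [|i _]; last first.
    by rewrite qbin0 mulr0 mul0r.
  by rewrite qbin0 mul0r expr0z !mul1r !add0r addr0 add0n.
under eq_bigr => m _ do rewrite qbinS' mulrDr mulrDl.
rewrite big_split /= IHl; last by lia.
rewrite big_ord_recl [qbin l (_ - 1)]qbin_lt0 // !(mulr0, mul0r) add0r.
rewrite (eq_bigr (fun m : 'I_N => q ^ (l%:Z + a + 1) *
  (q ^ (m%:Z * (m%:Z + (a + 1))) * qbin l m * qbin l' (m%:Z + (a + 1)))));
  last first.
  move=> m _; rewrite /= /bump /= !mulrA -!expzD.
  by congr (q ^ _ * qbin _ _ * qbin _ _); lia.
rewrite -mulr_sumr IHl // addSn [RHS]qbinS.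
by congr (qbin _ _ + q ^ _ * qbin _ _); lia.
Qed.

End QBinomial.

(** * The two quadratic transformations *)

Lemma sum_single (V : zmodType) (n i : nat) (c : V) :
  (c != 0 -> (i < n)%N) -> \sum_(j < n) (if i == j :> nat then c else 0) = c.
Proof.
have [-> _|c0 /(_ isT) ltin] := eqVneq c 0.
  by rewrite big1 // => j _; case: ifP.
rewrite (bigD1 (Ordinal ltin)) //= eqxx big1 ?addr0 // => j.
by rewrite -val_eqE /= eq_sym => /negPf ->.
Qed.

(** Change of variables when the supports, not the index ranges, are in bijection: both sides become
    double sums over [(i, j)] that agree term by term. *)
Lemma sum_transport (V : zmodType) (n p : nat) (f g : nat -> V) (h h' : nat -> nat) :
  (forall i, (i < n)%N -> f i != 0 -> [/\ (h i < p)%N, h' (h i) = i & g (h i) = f i]) ->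
  (forall j, (j < p)%N -> g j != 0 -> [/\ (h' j < n)%N, h (h' j) = j & f (h' j) = g j]) ->
  \sum_(i < n) f i = \sum_(j < p) g j.
Proof.
move=> hf hg.
under eq_bigr => i _.
  rewrite -(@sum_single V p (h i) (f i)); last first.
    by move=> fi0; case: (hf i (ltn_ord i) fi0).
  over.
under [RHS]eq_bigr => j _.
  rewrite -(@sum_single V n (h' j) (g j)); last first.
    by move=> gj0; case: (hg j (ltn_ord j) gj0).
  over.
rewrite exchange_big; apply: eq_bigr => j _; apply: eq_bigr => i _ /=.
case: eqP => [hij|nhij]; case: eqP => [hji|nhji] //.
- have [fi0|/(hf i (ltn_ord i))[_ _ <-]] := eqVneq (f i) 0; last by rewrite hij.
  have [-> //|/(hg j (ltn_ord j))[_ _ e]] := eqVneq (g j) 0.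
  by rewrite -e hji.
- have [//|/(hf i (ltn_ord i))[_ e _]] := eqVneq (f i) 0.
  by case: nhji; rewrite -hij.
- have [->//|/(hg j (ltn_ord j))[_ e _]] := eqVneq (g j) 0.
  by case: nhij; rewrite -hji.
Qed.

Definition tri (a : int) : int := ((a * (a + 1)) %/ 2)%Z.

Lemma double_tri a : 2 * tri a = a * (a + 1).
Proof.
rewrite /tri mulrC divzK //.
have [e|e] : a = 2 * (a %/ 2)%Z \/ a = 2 * (a %/ 2)%Z + 1 by lia.
- by apply: dvdz_mulr; lia.
- by apply: dvdz_mull; lia.
Qed.

Section Quadratic.
Variables (F : fieldType) (q : F).
Hypothesis q_gen : generic F q.
Let q_neq0 : q != 0 := proj1 q_gen.
Notation qfact := (qfact F q).
Notation iqfact := (iqfact F q).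
Notation qbin := (qbin F q).

(** The factorials of [l] and [L - l] cancel; what remains can be regrouped into another nesting of
    binomials. *)
Lemma qmultinomial (L l : nat) (m n : int) : (l <= L)%N ->
  qbin L l * qbin l m * qbin (L - l) n =
  qfact L * iqfact m * iqfact n * iqfact (l%:Z - m)
    * iqfact (L%:Z - l%:Z - n).
Proof.
move=> lL; rewrite !qbinE -[Posz (L - l)]subzn //.
have := qfact_neq0 F q q_gen l; have := qfact_neq0 F q q_gen (L - l).
rewrite (_ : iqfact (L%:Z - l%:Z) = (qfact (L - l))^-1); last by rewrite subzn.
rewrite [iqfact l]/= => h1 h2; field; by rewrite h1 h2.
Qed.

(* Reorders [L,l] [L,l+a] = sum_m q^(m(m+a)) [L,l] [l,m] [L-l,m+a]
   by r = 2m + a and k = l - m. *)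
Lemma central_split (L : nat) (a : int) (phi : int -> F) :
  \sum_(l < L.+1) phi l%:Z * qbin L l * qbin L (l%:Z + a) =
  \sum_(r < L.+1) \sum_(k < L.+1)
     if (2 %| r%:Z - a)%Z then
       let m := ((r%:Z - a) %/ 2)%Z in
       phi (k%:Z + m) * q ^ (m * (m + a)) * qbin L r * qbin (L - r) k * qbin r m
     else 0.
Proof.
(* A q-multinomial with parts [m], [m + a], [k] and the rest of [L], hence zero unless all four are
   non-negative. *)
pose G (m k : int) : F := phi (k + m) * q ^ (m * (m + a)) *
  (qfact L * iqfact m * iqfact (m + a) * iqfact k * iqfact (L%:Z - (k + m) - (m + a))).
have G0 m k : G m k != 0 -> [/\ 0 <= m, 0 <= m + a, 0 <= k & k + m + (m + a) <= L%:Z].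
  move=> h; split; rewrite leNgt; apply/negP => h'; move: h; rewrite /G.
  - by rewrite (iqfact_lt0 _ _ m) // !(mulr0, mul0r) eqxx.
  - by rewrite (iqfact_lt0 _ _ (m + a)) // !(mulr0, mul0r) eqxx.
  - by rewrite (iqfact_lt0 _ _ k) // !(mulr0, mul0r) eqxx.
  - by rewrite (iqfact_lt0 _ _ (_ - _ - _)) ?(mulr0, mul0r) ?eqxx //; lia.
transitivity (\sum_(l < L.+1) \sum_(m < L.+1) G m%:Z (l%:Z - m%:Z)).
  apply: eq_bigr => l _; have lL : (l <= L)%N by rewrite -ltnS.
  rewrite -[X in qbin X (_ + a)](subnKC lL) -(qVandermonde _ _ q_gen _ _ L.+1) //.
  rewrite mulr_sumr; apply: eq_bigr => m _.
  transitivity (phi l%:Z * q ^ (m%:Z * (m%:Z + a)) *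
     (qbin L l * qbin l m * qbin (L - l) (m%:Z + a))); first by ring.
  by rewrite qmultinomial // /G subrK.
transitivity (\sum_(m < L.+1) \sum_(k < L.+1) G m%:Z k%:Z).
  rewrite exchange_big; apply: eq_bigr => m _ /=.
  apply: (sum_transport _ _ _ (fun l => G m%:Z (l%:Z - m%:Z)) (fun k => G m%:Z k%:Z)
           (fun l => l - m)%N (fun k => k + m)%N) => i lti /G0[h1 h2 h3 h4].
  - split; [lia|lia|congr (G _ _); lia].
  - split; [lia|lia|congr (G _ _); lia].
rewrite exchange_big [RHS]exchange_big; apply: eq_bigr => k _ /=.
pose g (r : nat) := if (2 %| r%:Z - a)%Z then G ((r%:Z - a) %/ 2)%Z k%:Z else 0.
transitivity (\sum_(r < L.+1) g r).
  apply: (sum_transport _ _ _ (fun m : nat => G m%:Z k%:Z) g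
     (fun m : nat => absz (2 * m%:Z + a)) (fun r : nat => absz ((r%:Z - a) %/ 2)%Z)) => i lti.
  - move=> /G0[h1 h2 h3 h4]; split; [lia|lia|rewrite /g ifT; last lia].
    by congr (G _ _); lia.
  - rewrite /g; case: ifP; last by rewrite eqxx.
    move=> hd /G0[h1 h2 h3 h4]; split; [lia|lia|].
    by congr (G _ _); lia.
apply: eq_bigr => r _; have rL : (r <= L)%N by rewrite -ltnS.
rewrite /g; case: ifP => // hd /=; set m := (_ %/ 2)%Z.
have em : r%:Z = m + (m + a) by rewrite /m; lia.
rewrite /G -[RHS]mulrA -[RHS]mulrA -[in RHS]mulrA.
rewrite [qbin (L - r) _ * _]mulrC [qbin L r * _]mulrA qmultinomial //.
rewrite (_ : r%:Z - m = m + a); last lia.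
rewrite (_ : L%:Z - (k%:Z + m) - (m + a) = L%:Z - r%:Z - k%:Z); last lia.
by ring.
Qed.

Lemma qbin_central_even (L : nat) (a : int) :
  qbin (L + L) (L%:Z - a) =
  \sum_(r < L.+1) \sum_(k < L.+1)
     if (2 %| r%:Z - a)%Z then
       let m := ((r%:Z - a) %/ 2)%Z in
       q ^ ((k%:Z + m) * (k%:Z + m + a)) * q ^ (m * (m + a))
         * qbin L r * qbin (L - r) k * qbin r m
     else 0.
Proof.
rewrite qbin_sym // (_ : (L + L)%N%:Z - (L%:Z - a) = L%:Z + a); last lia.
by rewrite -(qVandermonde _ _ q_gen _ _ L.+1) //
   (central_split L a (fun l => q ^ (l * (l + a)))).
Qed.

(** By symmetry the lower index is [L + a + 1]; q-Pascal in the second Vandermonde factor leaves the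
    shifts [a] and [a + 1]. Their sums live on opposite parities of [r], which the floor merges. *)
Lemma qbin_central_odd (L : nat) (a : int) :
  q ^ tri a * qbin (L + L).+1 (L%:Z - a) =
  \sum_(r < L.+1) \sum_(k < L.+1)
     q ^ (tri r + k%:Z * k%:Z + k%:Z + k%:Z * r%:Z)
       * (qbin L r * qbin (L - r) k) * qbin r ((r%:Z - a) %/ 2)%Z.
Proof.
rewrite qbin_sym // (_ : (L + L).+1%:Z - (L%:Z - a) = L%:Z + (a + 1)); last lia.
rewrite -addnS -(qVandermonde _ _ q_gen _ _ L.+1) //.
transitivity (q ^ tri a * (
   (\sum_(l < L.+1) q ^ (l%:Z * (l%:Z + (a + 1))) * qbin L l * qbin L (l%:Z + a))
   + \sum_(l < L.+1) q ^ (l%:Z * (l%:Z + (a + 1)) + (l%:Z + (a + 1)))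
       * qbin L l * qbin L (l%:Z + (a + 1)))).
  rewrite -big_split; congr (_ * _); apply: eq_bigr => l _ /=.
  rewrite (qbinS _ _ q_gen) [in RHS](expzD _ _ q_gen (l%:Z * _))
    (_ : l%:Z + (a + 1) - 1 = l%:Z + a); last lia.
  by ring.
rewrite (central_split L a (fun l => q ^ (l * (l + (a + 1))))).
rewrite (central_split L (a + 1) (fun l => q ^ (l * (l + (a + 1)) + (l + (a + 1))))).
rewrite -big_split mulr_sumr; apply: eq_bigr => r _ /=.
rewrite -big_split mulr_sumr; apply: eq_bigr => k _ /=.
have hr := double_tri r; have ha := double_tri a.
set m := ((r%:Z - a) %/ 2)%Z.
case: ifP => hd.
  rewrite ifF ?addr0; last lia.
  rewrite !mulrA -!expzD //; congr (q ^ _ * _ * _ * _).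
  have e : r%:Z = 2 * m + a by lia.
  move: (tri r) (tri a) hr ha => x y; rewrite e => hr ha; lia.
rewrite ifT; last lia.
rewrite (_ : ((r%:Z - (a + 1)) %/ 2)%Z = m); last lia.
rewrite add0r !mulrA -!expzD //; congr (q ^ _ * _ * _ * _).
have e : r%:Z = 2 * m + a + 1 by lia.
move: (tri r) (tri a) hr ha => x y; rewrite e => hr ha; lia.
Qed.

End Quadratic.

(** * Positivity carried along the quadratic transformations *)

Section Positivity.
Variables (F : fieldType) (C : F -> Prop).

Definition semiring_cone := [/\ C 0, C 1, forall x y, C x -> C y -> C (x + y)
  & forall x y, C x -> C y -> C (x * y)].

Hypothesis hC : semiring_cone.

Lemma cone0 : C 0. Proof. by case: hC. Qed.
Lemma cone1 : C 1. Proof. by case: hC. Qed.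
Lemma coneD x y : C x -> C y -> C (x + y). Proof. by case: hC => _ _ + _; apply. Qed.
Lemma coneM x y : C x -> C y -> C (x * y). Proof. by case: hC => _ _ _; apply. Qed.

Lemma cone_sum (J : Type) (s : seq J) (f : J -> F) :
  (forall x, C (f x)) -> C (\sum_(x <- s) f x).
Proof. by move=> h; apply: big_ind => //; [exact: cone0|exact: coneD]. Qed.

Lemma coneX x n : C x -> C (x ^+ n).
Proof.
move=> h; elim: n => [|n IHn]; first by rewrite expr0; exact: cone1.
by rewrite exprS; apply: coneM.
Qed.

Lemma coneXz (q : F) (n : int) : C q -> C q^-1 -> C (q ^ n).
Proof.
move=> hq hqV; case: n => n; first exact: coneX.
by rewrite NegzE -invr_expz -exprVn; apply: coneX.
Qed.

Variable q : F.
Hypotheses (q_gen : generic F q) (Cq : C q).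
Notation qbin := (qbin F q).

Lemma cone_qbin m n : C (qbin m n).
Proof.
elim: m n => [|m IHm] n.
  by rewrite qbin0 //; case: (n == 0); [exact: cone1|exact: cone0].
case: n => n; last by rewrite qbin_lt0 //; exact: cone0.
rewrite qbinS //; apply: coneD => //; apply: coneM => //.
exact: (coneX q n).
Qed.

Hypothesis CqV : C q^-1.

Variables (I : Type) (w : seq I) (eps : I -> F) (E a : I -> int).

(** The kernel depends on [r] and [k] only, so after exchanging sums it factors out as an element of
    [C]. *)
Lemma odd_step (L : nat) :
  (forall r : nat, (r <= L)%N ->
     C (\sum_(x <- w) eps x * q ^ E x * qbin r ((r%:Z - a x) %/ 2)%Z)) ->
  C (\sum_(x <- w) eps x * q ^ (E x + tri (a x)) * qbin (L + L).+1 (L%:Z - a x)).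
Proof.
move=> h.
under eq_bigr => x _.
  rewrite expzD // mulrA -mulrA qbin_central_odd // mulr_sumr.
  under eq_bigr => r _ do rewrite mulr_sumr.
  over.
rewrite exchange_big; apply: cone_sum => r /=.
rewrite exchange_big; apply: cone_sum => k /=.
under eq_bigr => x _ do rewrite mulrCA.
rewrite -mulr_sumr; apply: coneM => //; last by apply: h; rewrite -ltnS.
by apply: coneM; [exact: coneXz|apply: coneM; exact: cone_qbin].
Qed.

(** All shifts share the parity of [b], so only [r] of that parity contribute, and subtracting
    [b * b] makes the added exponent [(a x * a x - b * b) / 2] an integer. *)
Lemma even_step (L : nat) (b : int) (E' : I -> int) :
  (forall x, (2 %| a x - b)%Z) ->
  (forall x, 2 * E' x = 2 * E x + a x * a x - b * b) ->
  (forall r : nat, (r <= L)%N -> (2 %| r%:Z - b)%Z ->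
     C (\sum_(x <- w) eps x * q ^ E x * qbin r ((r%:Z - a x) %/ 2)%Z)) ->
  C (\sum_(x <- w) eps x * q ^ E' x * qbin (L + L) (L%:Z - a x)).
Proof.
move=> hab hE h.
under eq_bigr => x _.
  rewrite qbin_central_even // mulr_sumr.
  under eq_bigr => r _ do rewrite mulr_sumr.
  over.
rewrite exchange_big; apply: cone_sum => r /=.
rewrite exchange_big; apply: cone_sum => k /=.
have [hr|hr] := boolP (2 %| r%:Z - b)%Z; last first.
  rewrite big1; first exact: cone0.
  by move=> x _; rewrite ifF ?mulr0 //; have := hab x; lia.
rewrite (eq_bigr (fun x => (q ^ (((r%:Z * r%:Z - b * b) %/ 2)%Z + k%:Z * k%:Z + k%:Z * r%:Z)
   * (qbin L r * qbin (L - r) k)) * (eps x * q ^ E x * qbin r ((r%:Z - a x) %/ 2)%Z))).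
  rewrite -mulr_sumr; apply: coneM; last by apply: h => //; rewrite -ltnS.
  by apply: coneM; [exact: coneXz|apply: coneM; exact: cone_qbin].
move=> x _; have hx := hab x; rewrite ifT; last lia.
set m := ((_ - a x) %/ 2)%Z.
transitivity (eps x * (q ^ E' x * q ^ ((k%:Z + m) * (k%:Z + m + a x)) * q ^ (m * (m + a x)))
    * (qbin L r * qbin (L - r) k * qbin r m)); first by ring.
rewrite -!expzD //.
have em : r%:Z = 2 * m + a x by lia.
(* Since [4 * m * (m + a x) = r * r - a x * a x], only [E x] still depends on [x]. *)
have -> : E' x + (k%:Z + m) * (k%:Z + m + a x) + m * (m + a x) =
   ((r%:Z * r%:Z - b * b) %/ 2)%Z + k%:Z * k%:Z + k%:Z * r%:Z + E x.
  have e2 : 2 * (E' x - E x + 2 * m * (m + a x)) = r%:Z * r%:Z - b * b.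
    by rewrite em; have := hE x; lia.
  by rewrite -e2 mulKz // em; lia.
by rewrite [X in eps x * X]expzD //; ring.
Qed.

End Positivity.

(** * The cubic transformation *)

Lemma generic_cube (F : fieldType) (q : F) : generic F q -> generic F (q ^+ 3).
Proof.
case=> q0 hq; split=> [|n]; first by rewrite expf_neq0.
by rewrite -exprM mulnS addSn.
Qed.

Section Cubic.
Variables (F : fieldType) (q : F).
Hypothesis q_gen : generic F q.
Let q3_gen : generic F (q ^+ 3) := generic_cube F q q_gen.
Notation qfact3 := (qfact F (q ^+ 3)).
Notation iqfact3 := (iqfact F (q ^+ 3)).
Notation qbin3 := (qbin F (q ^+ 3)).
Notation qfact := (qfact F q).
Notation iqfact := (iqfact F q).
Notation qbin := (qbin F q).

Lemma expz_cube n : (q ^+ 3) ^ n = (q ^ n) ^+ 3.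
Proof. by rewrite -[q ^+ 3]/(q ^ 3) exprz_exp mulrC -exprz_exp. Qed.

Lemma expz3 n : q ^ (3 * n) = (q ^ n) ^+ 3.
Proof. by rewrite mulrC -exprz_exp. Qed.

Lemma expz_neq1 (n : int) : 0 < n -> 1 - q ^ n != 0.
Proof.
case: n => [[|n]|n] // _; rewrite subr_eq0 eq_sym; exact: (proj2 q_gen n).
Qed.

Definition cubic_kernel (L r : nat) : F :=
  q ^ (3 * (r%:Z * r%:Z)) * (1 - q ^ (2 * L%:Z)) * qfact3 (L - r.+1)
    * iqfact (L%:Z - 3 * r%:Z) * iqfact3 (2 * r%:Z).

Definition cubic_summand (L r : nat) (a : int) : F :=
  q ^ (3 * (r%:Z * r%:Z)) * (1 - q ^ (2 * L%:Z)) * qfact3 (L - r.+1)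
    * iqfact (L%:Z - 3 * r%:Z) * iqfact3 (r%:Z - a) * iqfact3 (r%:Z + a).

Lemma cubic_summandE L r a :
  cubic_summand L r a = cubic_kernel L r * qbin3 (r + r) (r%:Z - a).
Proof.
rewrite /cubic_summand /cubic_kernel qbinE.
rewrite (_ : (r + r)%N%:Z - (r%:Z - a) = r%:Z + a); last lia.
have := qfactK _ _ q3_gen (r + r)%N.
rewrite (_ : Posz (r + r) = 2 * r%:Z); last lia.
move: (qfact3 _) => x; move: (iqfact3 (2 * _)) => y hxy.
have -> : forall z1 z2 z3, z1 * y * (x * z2 * z3) = z1 * z2 * z3 * (x * y) :> F.
  by move=> *; ring.
by rewrite hxy mulr1.
Qed.

(* Found by the q-Gosper algorithm. *)
Definition cubic_certificate (L r : nat) (a : int) : F :=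
  - (1 - q ^ (3 * (2 * a + 1))) * q ^ (3 * (r%:Z * r%:Z)) * (1 - q ^ (2 * L%:Z))
    * qfact3 (L - r) * iqfact3 (r%:Z - a - 1) * iqfact3 (r%:Z + a)
    * iqfact (L%:Z - 3 * r%:Z).

(** With [coef_cur], the coefficients of the first-order recurrence in [a] satisfied by [q^(3a^2)
    [2L, L-3a]]. *)
Definition coef_succ (L : nat) (a : int) : F :=
  (1 - q ^ (L%:Z + 3 * a + 1)) * (1 - q ^ (L%:Z + 3 * a + 2))
    * (1 - q ^ (L%:Z + 3 * a + 3)).

Definition coef_cur (L : nat) (a : int) : F :=
  q ^ (3 * (2 * a + 1)) * (1 - q ^ (L%:Z - 3 * a))
    * (1 - q ^ (L%:Z - 3 * a - 1)) * (1 - q ^ (L%:Z - 3 * a - 2)).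

(** Creative telescoping: the recurrence applied to the summand is a difference in [r]. After
    reduction to common inverse factorials this is a rational identity in powers of [q]. *)
Lemma cubic_telescope (L r : nat) (a : int) : (r < L)%N ->
  coef_succ L a * cubic_summand L r (a + 1) - coef_cur L a * cubic_summand L r a
  = cubic_certificate L r.+1 a - cubic_certificate L r a.
Proof.
move=> rL; rewrite /cubic_certificate /cubic_summand /coef_succ /coef_cur.
rewrite (_ : r%:Z - (a + 1) = r%:Z - a - 1); last lia.
rewrite (_ : r.+1%:Z - a - 1 = r%:Z - a); last lia.
rewrite (_ : r.+1%:Z + a = r%:Z + (a + 1)); last lia.
rewrite (_ : r%:Z + a = r%:Z + (a + 1) - 1); last lia.
rewrite (_ : L%:Z - 3 * r.+1%:Z = L%:Z - 3 * r%:Z - 1 - 1 - 1); last lia.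
rewrite (_ : (L - r = (L - r.+1).+1)%N); last lia.
rewrite qfactS -[(q ^+ 3) ^+ _]/((q ^+ 3) ^ (Posz (L - r.+1).+1)).
rewrite (_ : Posz (L - r.+1).+1 = L%:Z - r%:Z); last lia.
rewrite (_ : 3 * (r.+1%:Z * r.+1%:Z) = 3 * (r%:Z * r%:Z) + 3 * (r%:Z + r%:Z) + 3); last lia.
rewrite !iqfact_pred //.
move: (iqfact (L%:Z - 3 * r%:Z)) (iqfact3 (r%:Z - a)) (iqfact3 (r%:Z + (a + 1)))
  (qfact3 (L - r.+1)) => w u v z.
rewrite (_ : 2 * a = a + a); last lia.
rewrite (_ : 2 * L%:Z = L%:Z + L%:Z); last lia.
rewrite !expz_cube !expzD // -!invr_expz !expz3 !expzD //.
have e1 : q ^ 1 = q by [].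
have e2 : q ^ 2 = q ^+ 2 by [].
have e3 : q ^ 3 = q ^+ 3 by [].
rewrite ?e1 ?e2 ?e3.
have := expz_neq0 _ _ q_gen r; have := expz_neq0 _ _ q_gen a; have := proj1 q_gen.
move: (q ^ r%:Z) (q ^ a) (q ^ L%:Z) (q ^ (r%:Z * r%:Z)) => x A Q P q0 A0 x0.
by field; rewrite ?q0 ?A0 ?x0.
Qed.

(** Downward induction on [a], as induction on [m = L - 3a]: both sides obey the same recurrence in
    [a]. *)
Lemma cubic_sum_nat (L a m : nat) : (0 < L)%N -> (L = 3 * a + m)%N ->
  \sum_(r < L) cubic_summand L r a%:Z
  = q ^ (3 * (a%:Z * a%:Z)) * qbin (L + L) (L%:Z - 3 * a%:Z).
Proof.
move=> L0; elim/ltn_ind: m a => m IHm a eL.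
(* For [m < 3] the conditions [a <= r] and [3r <= L] leave only [r = a]. *)
have [m3|m3] := ltnP m 3.
  have aL : (a < L)%N by lia.
  rewrite (bigD1 (Ordinal aL)) //= big1 ?addr0; last first.
    move=> r; rewrite -val_eqE /= => ra; rewrite /cubic_summand.
    have [h|h] : (r < a)%N \/ (a < r)%N by lia.
      by rewrite (iqfact_lt0 _ _ (_ - a%:Z)) ?(mulr0, mul0r) //; lia.
    by rewrite (iqfact_lt0 _ _ (L%:Z - _)) ?(mulr0, mul0r) //; lia.
  rewrite /cubic_summand qbinE subrr -!mulrA; congr (_ * _).
  rewrite (_ : a%:Z + a%:Z = (a + a)%N); last lia.
  rewrite (_ : (L + L)%N%:Z - (L%:Z - 3 * a%:Z) = (6 * a + m)%N); last lia.
  rewrite (_ : L%:Z - 3 * a%:Z = m); last lia.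
  rewrite (_ : 2 * L%:Z = (6 * a + m + m)%N); last lia.
  rewrite (_ : (L + L = 6 * a + m + m)%N); last lia.
  have hc n : (q ^+ 3) ^+ n = q ^+ (3 * n) by rewrite exprM.
  have := qfact_neq0 _ _ q3_gen (a + a)%N; have := qfact_neq0 _ _ q_gen (6 * a + m)%N.
  case: m m3 eL {IHm} => [|[|[|//]]] _ eL.
  - rewrite (_ : (L - a.+1 = (a + a).-1)%N); last lia.
    rewrite !addn0 /iqfact /= !qfact0.
    have -> : (a + a = (a + a).-1.+1)%N by lia.
    rewrite qfactS hc -[q ^ _]/(q ^+ _) (_ : (3 * (a + a).-1.+1 = 6 * a)%N); last lia.
    move=> h1; rewrite mulf_eq0 negb_or => /andP[h2 h3] /=.
    by rewrite !invr1; field; rewrite h1 h2 h3.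
  - rewrite (_ : (L - a.+1 = (a + a))%N); last lia.
    rewrite !addn1 /iqfact /= !qfactS !qfact0 -[q ^ _]/(q ^+ _) expr1.
    rewrite mulf_eq0 negb_or => /andP[h1 h2] h3.
    by rewrite invr1; field; rewrite h1 h2 h3 /= (expz_neq1 1).
  - rewrite (_ : (L - a.+1 = (a + a).+1)%N); last lia.
    rewrite !addn2 /iqfact /= !qfactS !qfact0 -[q ^ _]/(q ^+ _) hc expr1.
    rewrite (_ : (3 * (a + a).+1 = (6 * a).+3)%N); last lia.
    rewrite !mulf_eq0 !negb_or => /andP[/andP[h1 h2] h3] h4.
    by rewrite invr1; field; rewrite h1 h2 h3 h4 /= (expz_neq1 1) // (expz_neq1 2).
have hc2 : coef_cur L a%:Z != 0.
  by rewrite /coef_cur !mulf_neq0 ?expz_neq0 ?expz_neq1 //; lia.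
apply: (mulfI hc2).
have /eqP := IHm (m - 3)%N ltac:(lia) a.+1 ltac:(lia).
rewrite (_ : a.+1%:Z = a%:Z + 1); last lia.
move/eqP => IH.
transitivity (coef_succ L a%:Z * (\sum_(r < L) cubic_summand L r (a%:Z + 1))).
  apply/eqP; rewrite eq_sym -subr_eq0 !mulr_sumr -sumrB; apply/eqP.
  under eq_bigr => r _ do rewrite cubic_telescope //.
  rewrite -(big_mkord xpredT (fun r => cubic_certificate L r.+1 a - cubic_certificate L r a)).
  (* Both boundary values contain an inverse factorial of a negative integer: [L - 3L] at [r = L],
     and [- a - 1] at [r = 0]. *)
  rewrite telescope_sumr // /cubic_certificate.
  rewrite [iqfact (L%:Z - _)]iqfact_lt0 ?[iqfact3 (0%:Z - _ - _)]iqfact_lt0; try lia.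
  by rewrite !(mulr0, mul0r) subrr.
rewrite IH !qbinE /coef_succ /coef_cur.
rewrite (_ : (L + L)%N%:Z - (L%:Z - 3 * (a%:Z + 1)) = L%:Z + 3 * a%:Z + 3); last lia.
rewrite (_ : (L + L)%N%:Z - (L%:Z - 3 * a%:Z) = L%:Z + 3 * a%:Z + 3 - 1 - 1 - 1); last lia.
rewrite (_ : L%:Z - 3 * (a%:Z + 1) = L%:Z - 3 * a%:Z - 1 - 1 - 1); last lia.
rewrite !iqfact_pred //.
rewrite (_ : L%:Z + 3 * a%:Z + 3 - 1 = L%:Z + 3 * a%:Z + 2); last lia.
rewrite (_ : L%:Z + 3 * a%:Z + 2 - 1 = L%:Z + 3 * a%:Z + 1); last lia.
rewrite (_ : L%:Z - 3 * a%:Z - 1 - 1 = L%:Z - 3 * a%:Z - 2); last lia.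
rewrite (_ : 3 * ((a%:Z + 1) * (a%:Z + 1)) = 3 * (a%:Z * a%:Z) + 3 * (2 * a%:Z + 1)); last lia.
by rewrite (expzD _ _ q_gen (3 * (a%:Z * a%:Z))); ring.
Qed.

Lemma cubic_sum (L : nat) (a : int) : (0 < L)%N ->
  q ^ (3 * (a * a)) * qbin (L + L) (L%:Z - 3 * a)
  = \sum_(r < L) cubic_kernel L r * qbin3 (r + r) (r%:Z - a).
Proof.
move=> L0; wlog a0 : a / 0 <= a => [hw|].
  have [/hw //|a0] := leP 0 a.
  have := hw (- a) ltac:(lia); rewrite mulrNN => e.
  rewrite qbin_sym // (_ : (L + L)%N%:Z - (L%:Z - 3 * a) = L%:Z - 3 * (- a)) ?e; last lia.
  apply: eq_bigr => r _; rewrite [in RHS]qbin_sym //; congr (_ * qbin3 _ _); lia.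
have [n ea] : exists n : nat, a = n by exists (absz a); lia.
rewrite ea; have [h|h] := leqP (3 * n) L.
  rewrite -(cubic_sum_nat L n (L - 3 * n)) //; last lia.
  by apply: eq_bigr => r _; rewrite cubic_summandE.
rewrite qbin_lt0 ?mulr0; last lia.
rewrite big1 // => r _; rewrite -cubic_summandE /cubic_summand.
have [h1|h1] := ltnP r n.
  by rewrite (iqfact_lt0 _ _ (_ - n%:Z)) ?(mulr0, mul0r) //; lia.
by rewrite (iqfact_lt0 _ _ (L%:Z - _)) ?(mulr0, mul0r) //; lia.
Qed.

Variable C : F -> Prop.
Hypotheses (hC : semiring_cone F C) (Cq : C q) (CqV : C q^-1).

Let Cq3 : C (q ^+ 3). Proof. exact: coneX. Qed.

(** Factor by factor, [(1 - q^(3m)) / (1 - q^m) = 1 + q^m + q^(2m)]. *)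
Lemma cone_cubic_ratio m : C (qfact3 m / qfact m).
Proof.
elim: m => [|m IHm]; first by rewrite !qfact0 divr1; exact: cone1.
have -> : qfact3 m.+1 / qfact m.+1
  = qfact3 m / qfact m * (1 + q ^+ m.+1 + q ^+ m.+1 * q ^+ m.+1).
  have := qfact_neq0 _ _ q_gen m.+1; rewrite !qfactS mulf_eq0 negb_or => /andP[h1 h2].
  by rewrite -exprM mulnC exprM; field; rewrite h1 h2.
apply: coneM => //; have h : C (q ^+ m.+1) by exact: coneX.
by apply: coneD => //; [apply: coneD => //; exact: cone1|exact: coneM].
Qed.

Lemma cone_cubic_kernel L r : (r < L)%N -> C (cubic_kernel L r).
Proof.
move=> rL; have [h|h] := ltnP L (3 * r).
  rewrite /cubic_kernel (iqfact_lt0 _ _ (L%:Z - _)) ?(mulr0, mul0r); last lia.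
  exact: cone0.
set m := (L - 3 * r)%N.
(* With m = L - 3r: 1 - q^(2L) = (1 - q^(6r)) + q^(6r) (1 - q^(2m)). *)
have -> : cubic_kernel L r = q ^ (3 * (r%:Z * r%:Z)) *
   (qbin3 (L - r.+1) m%:Z * (qfact3 m / qfact m)
    + q ^ (6 * r%:Z) * (if m is n.+1 then
        qbin3 (L - r.+1) n%:Z * (qfact3 n / qfact n) * (1 + q ^+ m) else 0)).
  rewrite /cubic_kernel !qbinE -!mulrA; congr (_ * _).
  rewrite (_ : L%:Z - 3 * r%:Z = m); last by rewrite /m; lia.
  rewrite (_ : Posz (L - r.+1) - m%:Z = 2 * r%:Z - 1); last by rewrite /m; lia.
  rewrite iqfact_pred // expz_cube.
  rewrite (_ : 2 * L%:Z = 6 * r%:Z + m%:Z + m%:Z); last by rewrite /m; lia.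
  rewrite (_ : 6 * r%:Z = 3 * (2 * r%:Z)) ?expzD ?expz3 //; last lia.
  have em : (L = 3 * r + m)%N by rewrite /m; lia.
  move: m em => [|n] em.
    rewrite /= !qfact0 expr0z; rewrite invr1; ring.
  rewrite qbinE (_ : Posz (L - r.+1) - n%:Z = 2 * r%:Z); last lia.
  move: (iqfact3 (2 * r%:Z)) => y; rewrite /iqfact /=.
  have := qfact_neq0 _ _ q_gen n.+1; have := qfact_neq0 _ _ q3_gen n.+1.
  rewrite -[q ^ n.+1]/(q ^+ n.+1) !qfactS !mulf_eq0 !negb_or => /andP[h1 h2] /andP[h3 h4].
  by field; rewrite h1 h2 h3 h4.
apply: coneM => //; first exact: coneXz.
apply: coneD => //; first by apply: coneM => //; [exact: cone_qbin|exact: cone_cubic_ratio].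
apply: coneM => //; first exact: coneXz.
move: (m) => [|n]; first exact: cone0.
apply: coneM => //; last by apply: coneD => //; [exact: cone1|exact: coneX].
by apply: coneM => //; [exact: cone_qbin|exact: cone_cubic_ratio].
Qed.

Variables (I : Type) (w : seq I) (eps : I -> F) (E a : I -> int).

(** The kernel vanishes for [3 * r > L]; restricting the premise accordingly lets the window bound
    scale by 3 in [central_positive_triple]. *)
Lemma cubic_step (L : nat) :
  (forall r : nat, (3 * r <= L)%N ->
     C (\sum_(x <- w) eps x * (q ^+ 3) ^ E x * qbin3 (r + r) (r%:Z - a x))) ->
  C (\sum_(x <- w) eps x * q ^ (3 * E x + 3 * (a x * a x)) * qbin (L + L) (L%:Z - 3 * a x)).
Proof.
(* At [L = 0] the sum in [cubic_sum] is empty; there both binomials are the indicator of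
   [a x = 0]. *)
case: L => [|L] h.
  rewrite (eq_bigr (fun x => eps x * (q ^+ 3) ^ E x * qbin3 (0 + 0) (0%:Z - a x))).
    exact: (h 0%N (leq0n _)).
  move=> x _; rewrite !qbin0 //; have [->|/negPf a0] := eqVneq (a x) 0.
    by rewrite !mulr0 addr0 expz3 expz_cube.
  have -> : (0%:Z - a x == 0) = false by move: a0; lia.
  have -> : (0%:Z - 3 * a x == 0) = false by move: a0; lia.
  by rewrite !mulr0.
have assoc (x y z t : F) : x * (y * z) * t = x * y * (z * t) by ring.
under eq_bigr => x _.
  rewrite expzD // assoc cubic_sum // expz3 -expz_cube mulr_sumr.
  over.
rewrite exchange_big; apply: cone_sum => //= r.
under eq_bigr => x _ do rewrite mulrCA.
have [hr|hr] := leqP (3 * r) L.+1.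
  by rewrite -mulr_sumr; apply: coneM => //; [exact: cone_cubic_kernel|exact: h].
rewrite big1; first exact: cone0.
move=> x _; rewrite /cubic_kernel (iqfact_lt0 _ _ (_ - 3 * _)) ?(mulr0, mul0r) //; lia.
Qed.

End Cubic.

(** * Hook differences *)

Definition window (B : nat) : seq int := [seq (j%:Z - B%:Z) | j <- iota 0 (2 * B + 1)].

Lemma window_sum (V : zmodType) (B : nat) (f : int -> V) :
  \sum_(j <- window B) f j = \sum_(0 <= k < 2 * B + 1) f (k%:Z - B%:Z).
Proof. by rewrite big_map /index_iota subn0. Qed.

Lemma window_sum_opp (V : zmodType) (B : nat) (f : int -> V) :
  \sum_(j <- window B) f j = \sum_(j <- window B) f (- j).
Proof.
rewrite !window_sum big_nat_rev !big_mkord; apply: eq_bigr => k _.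
congr f; have := ltn_ord k; lia.
Qed.

(** The shift trades the summand at [B] for the one at [- B - 1]; the difference telescopes. *)
Lemma window_sum_pred (V : zmodType) (B : nat) (f : int -> V) :
  f B%:Z = f (- B%:Z - 1) ->
  \sum_(j <- window B) f j = \sum_(j <- window B) f (j - 1).
Proof.
move=> e; apply/eqP; rewrite -subr_eq0 -sumrB window_sum.
rewrite (eq_bigr (fun k : nat => f (k.+1%:Z - B%:Z - 1) - f (k%:Z - B%:Z - 1))); last first.
  by move=> k _; congr (f _ - _); lia.
rewrite (telescope_sumr (fun k : nat => f (k%:Z - B%:Z - 1))) //.
rewrite subr_eq0; apply/eqP.
by rewrite (_ : (2 * B + 1)%N%:Z - B%:Z - 1 = B%:Z) ?e; [congr f|]; lia.
Qed.

Section HookDifferences.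
Variables (F : fieldType) (q : F) (C : F -> Prop).
Hypothesis q_gen : generic F q.
Hypotheses (hC : semiring_cone F C) (Cq : C q) (CqV : C q^-1).
Notation qbin := (qbin F q).
Variables (K i : int) (B : nat).
Hypotheses (i_gt0 : 0 < i) (i_ltK : i < K).

Let pos_term (m : nat) (M al be j : int) : F :=
  q ^ (j * ((al + be) * (K * j) + K * be - (al + be) * i)) * qbin m (M - K * j).
Let neg_term (m : nat) (M al be j : int) : F :=
  q ^ (((al + be) * j + be) * (K * j + i)) * qbin m (M - K * j - i).

(* [m] is M + N, so that N - M + i reads [m - 2 * M + i]. *)
Definition hook_sum (m : nat) (M al be : int) : F :=
  \sum_(j <- window B) (pos_term m M al be j - neg_term m M al be j).

Let pascal_term (M e e' f f' d1 d2 : int) (b1 b2 c1 c2 : F) :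
  e + d1 = M + e' -> f + d2 = M + f' ->
  q ^ e * (b1 + q ^ d1 * b2) - q ^ f * (c1 + q ^ d2 * c2)
  = q ^ e * b1 - q ^ f * c1 + q ^ M * (q ^ e' * b2 - q ^ f' * c2).
Proof.
move=> h1 h2; rewrite !mulrDr !mulrN !mulrA -!expzD // h1 h2; ring.
Qed.

(** Termwise q-Pascal. The factors [q^(M - K j)] and [q^(M - K j - i)] amount to a common [q^M] and
    a unit moved from [be] to [al]. *)
Lemma hook_sum_rec1 m M al be :
  hook_sum m.+1 M al be
  = hook_sum m (M - 1) al be + q ^ M * hook_sum m M (al + 1) (be - 1).
Proof.
rewrite /hook_sum mulr_sumr -big_split; apply: eq_bigr => j _ /=.
rewrite /pos_term /neg_term !(qbinS _ _ q_gen).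
rewrite (_ : M - K * j - 1 = M - 1 - K * j); last lia.
rewrite (_ : M - K * j - i - 1 = M - 1 - K * j - i); last lia.
by apply: pascal_term; lia.
Qed.

Lemma hook_sum_rec2 m M al be :
  hook_sum m.+1 M al be
  = hook_sum m M al be
    + q ^ (m.+1%:Z - M) * hook_sum m (M - 1) (al - 1) (be + 1).
Proof.
rewrite /hook_sum mulr_sumr -big_split; apply: eq_bigr => j _ /=.
rewrite /pos_term /neg_term !(qbinS' _ _ q_gen).
rewrite (_ : M - K * j - 1 = M - 1 - K * j); last lia.
rewrite (_ : M - K * j - i - 1 = M - 1 - K * j - i); last lia.
by apply: pascal_term; lia.
Qed.

(** Under [j -> - j] and the symmetry of the q-binomial the positive terms become the negative
    ones. *)
Lemma hook_sum_beta0 m M al :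
  m%:Z - 2 * M + i = 0 -> hook_sum m M al 0 = 0.
Proof.
move=> hM; rewrite /hook_sum sumrB [X in X - _]window_sum_opp -sumrB.
rewrite big1 // => j _; rewrite /pos_term /neg_term [X in _ * X - _]qbin_sym //.
by apply/eqP; rewrite subr_eq0; apply/eqP; congr (q ^ _ * qbin _ _); lia.
Qed.

(* The reflection j -> -1 - j moves the window by one; [M < K * B] makes the two
   summands at its ends vanish. *)
Lemma hook_sum_alpha0 m M be : M < K * B%:Z ->
  m%:Z - 2 * M + i = K -> hook_sum m M 0 be = 0.
Proof.
move=> MB hM; rewrite /hook_sum sumrB [X in X - _]window_sum_pred; last first.
  by rewrite /pos_term qbin_lt0 ?qbin_gt ?mulr0 //; nia.
rewrite [X in X - _]window_sum_opp -sumrB.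
rewrite big1 // => j _; rewrite /pos_term /neg_term [X in _ * X - _]qbin_sym //.
by apply/eqP; rewrite subr_eq0; apply/eqP; congr (q ^ _ * qbin _ _); lia.
Qed.

(** Induction on the upper index. With [x] the middle quantity of the bounds, the first recurrence
    needs [be >= 1] and [x < K - al], the second [al >= 1] and [be < x]; if both fail,
    [0 < al + be < K] leaves exactly the two reflection cases. *)
Lemma hook_sum_positive m M al be :
  0 <= al -> 0 <= be -> 0 < al + be < K ->
  be <= m%:Z - 2 * M + i -> m%:Z - 2 * M + i <= K - al ->
  M < K * B%:Z -> C (hook_sum m M al be).
Proof.
elim: m M al be => [|m IHm] M al be al0 be0 /andP[ab0 abK] hx1 hx2 MB.
  rewrite /hook_sum; apply: cone_sum => // j.
  (* A negative term at [m = 0] would need [M = K j + i], which the bounds on [i - 2M] exclude. *)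
  rewrite /neg_term qbin0 // (_ : (M - K * j - i == 0) = false) ?mulr0 ?subr0; last first.
    apply/negP => /eqP h; have [h1|[h1|h1]] : j <= -1 \/ j = 0 \/ 1 <= j by lia.
    - nia.
    - lia.
    - nia.
  by apply: coneM => //; [exact: coneXz|exact: cone_qbin].
have [h1|h1] := boolP ((1 <= be) && (m.+1%:Z - 2 * M + i < K - al)).
  rewrite hook_sum_rec1; apply: coneD => //; first by apply: IHm; lia.
  by apply: coneM => //; [exact: coneXz|apply: IHm; lia].
have [h2|h2] := boolP ((1 <= al) && (be < m.+1%:Z - 2 * M + i)).
  rewrite hook_sum_rec2; apply: coneD => //; first by apply: IHm; lia.
  by apply: coneM => //; [exact: coneXz|apply: IHm; lia].
have [[be_0 hx]|[al_0 hx]] : (be = 0 /\ m.+1%:Z - 2 * M + i = 0) \/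
  (al = 0 /\ m.+1%:Z - 2 * M + i = K).
  lia.
- by rewrite be_0 hook_sum_beta0 //; exact: cone0.
- by rewrite al_0 hook_sum_alpha0 //; exact: cone0.
Qed.
End HookDifferences.

(** * Iterating the transformations *)

Section Iteration.
Variables (F : fieldType) (C : F -> Prop).
Hypothesis hC : semiring_cone F C.
Variables (I : Type) (w : seq I) (eps : I -> F).

Definition positive_param (q : F) := [/\ generic F q, C q & C q^-1].

(* For a shift [a x] = c + K j or c + K j + i, the bound [X = K B] says that no
   non-zero summand lies beyond the right end of the window |j| <= B. *)
Definition central_positive (q : F) (a E : I -> int) (c X : int) :=
  forall L : nat, L%:Z - c < X ->
    C (\sum_(x <- w) eps x * q ^ E x * qbin F q (L + L) (L%:Z - a x)).

(** [even_step] with [b = 0]: only even lengths [r = 2s] occur, so the bound doubles. *)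
Lemma central_positive_double q a E c X : positive_param q ->
  central_positive q a E c X ->
  central_positive q (fun x => 2 * a x) (fun x => E x + 2 * (a x * a x)) (2 * c) (2 * X).
Proof.
case=> hq Cq CqV h L hL.
apply: (even_step _ _ hC q hq Cq CqV _ _ _ E (fun x => 2 * a x) L 0).
- by move=> x; lia.
- by move=> x; lia.
move=> r rL hr; have [s es] : exists s : nat, r = (s + s)%N by exists (r./2); lia.
have hs : s%:Z - c < X by lia.
rewrite es; rewrite (eq_bigr (fun x => eps x * q ^ E x * qbin F q (s + s) (s%:Z - a x))).
  exact: h.
by move=> x _; congr (_ * qbin _ _ _ _); lia.
Qed.

Lemma central_positive_triple q a E c X : positive_param q ->
  central_positive (q ^+ 3) a E c X ->
  central_positive q (fun x => 3 * a x) (fun x => 3 * E x + 3 * (a x * a x)) (3 * c) (3 * X).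
Proof.
case=> hq Cq CqV h L hL.
apply: (cubic_step _ _ hq _ hC Cq CqV) => r hr; apply: h; lia.
Qed.

(** Coefficient of [a^2] collected by [k] doublings: the one applied to the shift [2^i a] adds
    [2 * 4^i a^2]. *)
Definition double_excess (k : nat) : int := 2 * \sum_(i < k) 4 ^+ i.

Lemma double_excessE k : 3 * double_excess k = 2 * (4 ^+ k - 1).
Proof.
rewrite /double_excess; elim: k => [|k IHk]; first by rewrite big_ord0.
rewrite big_ord_recr /= exprS; move: IHk.
by move: (\sum_(i < k) _) (4 ^+ k) => S x; lia.
Qed.

(** Coefficient of [a^2] after [t] triplings: each triples the old exponent, which belongs to [q^3],
    and adds three times the square of the current shift. *)
Fixpoint triple_excess (t : nat) : int :=
  if t is u.+1 then 3 * triple_excess u + 3 * (3 ^+ u * 3 ^+ u) else 0.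

Lemma triple_excessE t : 2 * triple_excess t = 3 ^+ t * 3 ^+ t - 3 ^+ t.
Proof. by elim: t => [|t IHt] //=; rewrite exprS; lia. Qed.

Lemma central_positive_congr q a a' E E' c c' X X' :
  a =1 a' -> E =1 E' -> c = c' -> X = X' ->
  central_positive q a E c X -> central_positive q a' E' c' X'.
Proof.
move=> ha hE <- <- h L /h; under eq_bigr => x _ do rewrite ha hE.
by [].
Qed.

Lemma central_positive_iter_double q a E c X k : positive_param q ->
  central_positive q a E c X ->
  central_positive q (fun x => 2 ^+ k * a x)
    (fun x => E x + double_excess k * (a x * a x)) (2 ^+ k * c) (2 ^+ k * X).
Proof.
move=> hq h; elim: k => [|k IHk].
  apply: central_positive_congr h => [x|x||]; rewrite ?expr0 ?mul1r //.
  by rewrite /double_excess big_ord0 mulr0 mul0r addr0.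
apply: central_positive_congr (central_positive_double _ _ _ _ _ hq IHk) => [x|x||];
  rewrite ?exprS ?mulrA //.
rewrite /double_excess big_ord_recr /= (_ : 4 ^+ k = 2 ^+ k * 2 ^+ k :> int); first by ring.
by rewrite -exprMn.
Qed.

Lemma positive_param_cube q : positive_param q -> positive_param (q ^+ 3).
Proof.
by case=> hq Cq CqV; split; [exact: generic_cube|exact: coneX|rewrite -exprVn; exact: coneX].
Qed.

(** Positivity is assumed for every admissible parameter because a tripling at [q] consumes the
    claim at [q^3]. *)
Lemma central_positive_iter_triple q a E c X t :
  (forall q, positive_param q -> central_positive q a E c X) -> positive_param q ->
  central_positive q (fun x => 3 ^+ t * a x)
    (fun x => 3 ^+ t * E x + triple_excess t * (a x * a x)) (3 ^+ t * c) (3 ^+ t * X).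
Proof.
move=> h; elim: t q => [|t IHt] q hq.
  apply: central_positive_congr (h q hq) => [x|x||]; rewrite ?expr0 ?mul1r //.
  by rewrite mul0r addr0.
apply: central_positive_congr
  (central_positive_triple _ _ _ _ _ hq (IHt _ (positive_param_cube _ hq))) => [x|x||];
  rewrite ?exprS ?mulrA //=.
by ring.
Qed.

End Iteration.

(** * The hook-difference sums under the transformations *)

Section HookFamily.
Variables (F : fieldType) (C : F -> Prop).
Hypothesis hC : semiring_cone F C.
Variables (p p' : nat) (r s : int) (B : nat).
Hypotheses (ltpp' : (p < p')%N) (r_gt0 : 0 < r) (ltrp : r < p%:Z).
Hypotheses (s_gt0 : 0 < s) (ltsp' : s < p'%:Z).

(* [(false, j)] and [(true, j)] index the first and the second [q]-binomial
   in the [j]-th summand. *)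
Definition hook_index : seq (bool * int) :=
  [seq (false, j) | j <- window B] ++ [seq (true, j) | j <- window B].

Definition hook_sign (x : bool * int) : F := if x.1 then -1 else 1.

Definition hook_exp (x : bool * int) : int :=
  if x.1 then (p%:Z * x.2 + r) * (p'%:Z * x.2 + s)
  else x.2 * (p%:Z * (p'%:Z * x.2) + p'%:Z * r - p%:Z * s).

(** Chosen so that [floor((m - hook_shift x) / 2)] is the lower index [M - p'j] or [M - p'j - s],
    where [M = floor((m - (r - s)) / 2)]. *)
Definition hook_shift (x : bool * int) : int :=
  r - s + 2 * (p'%:Z * x.2) + (if x.1 then 2 * s else 0).

Lemma hook_index_sum (V : zmodType) (f : bool * int -> V) :
  \sum_(x <- hook_index) f x
  = \sum_(j <- window B) f (false, j) + \sum_(j <- window B) f (true, j).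
Proof. by rewrite /hook_index big_cat !big_map. Qed.

(** The floor puts [m - 2M + s] in [{r, r + 1}], which lies between [be = r] and
    [K - al = p' - p + r] because [p < p']. *)
Lemma hook_family_floor (q : F) (m : nat) : positive_param F C q ->
  m%:Z - (r - s) < 2 * (p'%:Z * B%:Z) ->
  C (\sum_(x <- hook_index) hook_sign x * q ^ hook_exp x
       * qbin F q m ((m%:Z - hook_shift x) %/ 2)%Z).
Proof.
case=> hq Cq CqV hm; rewrite hook_index_sum -big_split.
set M := ((m%:Z - (r - s)) %/ 2)%Z.
suff : C (hook_sum F q p' s B m M (p%:Z - r) r).
  rewrite /hook_sum; congr C; apply: eq_bigr => j _.
  rewrite /hook_sign /hook_exp /hook_shift /= mul1r mulN1r mulNr.
  by congr (q ^ _ * qbin _ _ _ _ - q ^ _ * qbin _ _ _ _); rewrite /M; lia.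
by apply: hook_sum_positive => //; rewrite /M; lia.
Qed.

(** The odd transformation adds [tri a]; the even one, on the odd shifts [2a + 1] with [b = 1], adds
    [((2a + 1)^2 - 1) / 2 = 4 tri a]. *)
Lemma hook_family_central (q : F) : positive_param F C q ->
  central_positive F C _ hook_index hook_sign q (fun x => 2 * hook_shift x + 1)
    (fun x => hook_exp x + 5 * tri (hook_shift x))
    (2 * (r - s) + 1) (4 * (p'%:Z * B%:Z)).
Proof.
move=> hqp; have [hq Cq CqV] := hqp; move=> L hL.
apply: (even_step _ _ hC q hq Cq CqV _ _ _ (fun x => hook_exp x + tri (hook_shift x))
  (fun x => 2 * hook_shift x + 1) L 1).
- by move=> x; lia.
- by move=> x; have := double_tri (hook_shift x); lia.
move=> m mL hm; have [l el] : exists l : nat, m = (l + l).+1 by exists (m./2); lia.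
rewrite el (eq_bigr (fun x => hook_sign x * q ^ (hook_exp x + tri (hook_shift x))
   * qbin F q (l + l).+1 (l%:Z - hook_shift x))); last first.
  by move=> x _; congr (_ * qbin _ _ _ _); lia.
apply: (odd_step _ _ hC q hq Cq CqV) => m' hm'.
by apply: hook_family_floor => //; lia.
Qed.

Lemma hook_family_iterated (q : F) (t k : nat) : positive_param F C q ->
  central_positive F C _ hook_index hook_sign q
    (fun x => 3 ^+ t * (2 ^+ k * (2 * hook_shift x + 1)))
    (fun x => 3 ^+ t * (hook_exp x + 5 * tri (hook_shift x)
         + double_excess k * ((2 * hook_shift x + 1) * (2 * hook_shift x + 1)))
       + triple_excess t * ((2 ^+ k * (2 * hook_shift x + 1))
                            * (2 ^+ k * (2 * hook_shift x + 1))))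
    (3 ^+ t * (2 ^+ k * (2 * (r - s) + 1)))
    (3 ^+ t * (2 ^+ k * (4 * (p'%:Z * B%:Z)))).
Proof.
move=> hq.
apply: (central_positive_iter_triple _ _ hC _ _ _ _ _ _ _ _ _ _ hq) => {}q {}hq.
apply: (central_positive_iter_double _ _ hC _ _ _ _ _ _ _ _ _ hq).
exact: hook_family_central.
Qed.

End HookFamily.

(** * Laurent polynomials with non-negative coefficients *)

Notation ratfun := {fraction {poly rat}}.
Definition Xfrac : ratfun := tofrac 'X.

Definition laurent_nonneg (f : ratfun) : Prop :=
  exists (n : nat) (P : {poly rat}),
    (forall i, 0 <= P`_i) /\ f * Xfrac ^+ n = tofrac P.

Lemma generic_Xfrac : generic ratfun Xfrac.
Proof.
split=> [|n]; first by rewrite tofrac_eq0 polyX_eq0.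
rewrite -tofracXn -tofrac1 tofrac_eq; apply/eqP => /(congr1 (fun P : {poly rat} => size P)).
by rewrite size_polyXn size_poly1.
Qed.

Lemma laurent_cone : semiring_cone ratfun laurent_nonneg.
Proof.
split.
- by exists 0%N, 0; split=> [i|]; rewrite ?coef0 // mul0r tofrac0.
- exists 0%N, 1; split=> [i|]; last by rewrite expr0 mulr1 tofrac1.
  by rewrite coef1; case: (_ == _).
- move=> x y [n [P [P0 eP]]] [m [Q [Q0 eQ]]].
  exists (n + m)%N, (P * 'X^m + Q * 'X^n); split=> [i|].
    by rewrite coefD !coefMXn addr_ge0 //; case: ifP.
  rewrite tofracD !tofracM !tofracXn -eP -eQ -/Xfrac exprD; ring.
move=> x y [n [P [P0 eP]]] [m [Q [Q0 eQ]]].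
exists (n + m)%N, (P * Q); split=> [i|].
  by rewrite coefM sumr_ge0 // => j _; rewrite mulr_ge0.
by rewrite tofracM -eP -eQ exprD; ring.
Qed.

Lemma laurent_Xfrac : laurent_nonneg Xfrac.
Proof.
exists 0%N, 'X; split=> [i|]; last by rewrite expr0 mulr1.
by rewrite coefX; case: (_ == _).
Qed.

Lemma laurent_XfracV : laurent_nonneg Xfrac^-1.
Proof.
exists 1%N, 1; split=> [i|]; last by rewrite expr1 mulVf ?tofrac1 // (proj1 generic_Xfrac).
by rewrite coef1; case: (_ == _).
Qed.

Lemma qfact_tofrac m : qfact ratfun Xfrac m = tofrac (qpoch m).
Proof.
rewrite /qfact /qpoch rmorph_prod; apply: eq_bigr => k _.
by rewrite rmorphB rmorph1 rmorphXn.
Qed.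

(** The division in [qbinom] is exact by [cone_qbin] for the cone of all polynomials. *)
Lemma qbinom_tofrac (m : nat) (n : int) :
  tofrac (qbinom m%:Z n) = qbin ratfun Xfrac m n.
Proof.
have hX := generic_Xfrac.
have hP : semiring_cone ratfun (fun f => exists P : {poly rat}, f = tofrac P).
  split; [by exists 0; rewrite tofrac0|by exists 1; rewrite tofrac1| |].
  - by move=> _ _ [P ->] [Q ->]; exists (P + Q); rewrite tofracD.
  - by move=> _ _ [P ->] [Q ->]; exists (P * Q); rewrite tofracM.
have [P eP] := cone_qbin _ _ hP _ hX (ex_intro _ 'X erefl) m n.
rewrite /qbinom; case: ifP => [/andP[n0 nm]|nn]; last first.
  rewrite tofrac0; have [h|h] := ltP n 0; first by rewrite qbin_lt0.
  by rewrite qbin_gt //; lia.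
rewrite eP; congr tofrac.
have [k ek] : exists k : nat, n = k by exists (absz n); lia.
have km : (k <= m)%N by lia.
have -> : absz (m%:Z - n) = (m - k)%N by lia.
have hk j : qpoch j != 0 by rewrite -tofrac_eq0 -qfact_tofrac qfact_neq0.
have -> : qpoch (absz m%:Z) = P * (qpoch (absz n) * qpoch (m - k)).
  apply/eqP; rewrite -tofrac_eq !tofracM -eP -!qfact_tofrac ek /=; apply/eqP.
  exact/esym/qbin_qfact.
by rewrite mulpK // mulf_neq0.
Qed.

Lemma shift_coef_int (n : nat) (E e : int) (P : {poly rat}) : - n%:Z <= E ->
  shift_coef E%:~R P e%:~R
  = (if 0 <= e + n%:Z then (P * 'X^(absz (E + n%:Z)))`_(absz (e + n%:Z)) else 0).
Proof.
move=> hE; rewrite /shift_coef -intrB.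
have [h|h] := leP 0 (e - E).
  have [d ed] : exists d : nat, e - E = d by exists (absz (e - E)); lia.
  rewrite ed -pmulrn natr_nat natrK ifT; last lia.
  rewrite coefMXn ifF; last lia.
  by congr (_`_ _); lia.
rewrite ifF; last first.
  by apply/negP => /natrP[d] /eqP; rewrite pmulrn eqr_int => /eqP; lia.
case: ifP => // h2; rewrite coefMXn ifT //; lia.
Qed.

Lemma shift_coef_nonint (E : int) (e : rat) (P : {poly rat}) :
  e \isn't a Num.int -> shift_coef E%:~R P e = 0.
Proof.
move=> he; rewrite /shift_coef ifF //; apply/negP => /natrP[d ed].
by case/negP: he; rewrite -[e](subrK E%:~R) ed; apply: rpredD; rewrite ?intr_int ?rpred_nat.
Qed.

(** Multiplication by [X^n] clears all negative exponents and turns the sum into a polynomial [S]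
    with [S X^n0 = Q X^n]. At a non-integral [e] every summand is 0. *)
Lemma laurent_coef_ge0 (I : eqType) (w : seq I) (sgn : I -> bool) (E : I -> int)
    (P : I -> {poly rat}) (e : rat) :
  laurent_nonneg (\sum_(x <- w) (if sgn x then -1 else 1) * Xfrac ^ E x * tofrac (P x)) ->
  0 <= \sum_(x <- w) (if sgn x then -1 else 1) * shift_coef (E x)%:~R (P x) e.
Proof.
move=> [n0 [Q [Q0 eQ]]].
have [/intrP[z ->]|he] := boolP (e \is a Num.int); last first.
  by rewrite big1 // => x _; rewrite shift_coef_nonint // mulr0.
pose n := (\max_(x <- w) absz (E x))%N.
have hn x : x \in w -> - n%:Z <= E x.
  move=> hx; have : (absz (E x) <= n)%N by apply: (leq_bigmax_seq (F := fun y => absz (E y)) x hx).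
  lia.
rewrite (eq_big_seq (fun x => if 0 <= z + n%:Z then
   ((if sgn x then -1 else 1) * (P x * 'X^(absz (E x + n%:Z))))`_(absz (z + n%:Z)) else 0));
  last first.
  move=> x /hn hx; rewrite (shift_coef_int n) //; case: (0 <= z + n%:Z); last by rewrite mulr0.
  by case: (sgn x); rewrite ?mulN1r ?mul1r ?coefN.
case: (0 <= z + n%:Z); last by rewrite big1.
rewrite -coef_sum.
set S := \sum_(x <- w) _.
have eS : S * 'X^n0 = Q * 'X^n.
  apply/eqP; rewrite -tofrac_eq !tofracM !tofracXn -eQ -/Xfrac; apply/eqP.
  rewrite mulrAC; congr (_ * _); rewrite mulr_suml rmorph_sum /=.
  apply: eq_big_seq => x /hn hx.
  rewrite !tofracM tofracXn -/Xfrac -[Xfrac ^+ absz _]/(Xfrac ^ (absz (E x + n%:Z))).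
  rewrite (_ : Posz (absz _) = E x + n%:Z); last lia.
  rewrite (expzD _ _ generic_Xfrac).
  by case: (sgn x); rewrite ?tofracN tofrac1 -[Xfrac ^+ n]/(Xfrac ^ n); ring.
have -> : S`_(absz (z + n%:Z)) = (S * 'X^n0)`_(absz (z + n%:Z) + n0).
  by rewrite coefMXn ifF ?addnK //; lia.
by rewrite eS coefMXn; case: ifP.
Qed.

(** * Matching the exponents with those of the theorem *)

Section Exponents.
Variables (p p' : nat) (r s : int) (t k : nat).

Definition iterated_exp (E a : int) : int :=
  3 ^+ t * (E + 5 * tri a + double_excess k * ((2 * a + 1) * (2 * a + 1)))
  + triple_excess t * ((2 ^+ k * (2 * a + 1)) * (2 ^+ k * (2 * a + 1))).

(** The value at [b] is subtracted as a normalisation: with [b = r - s], the shift of the first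
    binomial at [j = 0], the exponent there becomes 0, as in [D]. *)
Lemma iterated_expE (E a b : int) :
  (iterated_exp E a - iterated_exp 0 b)%:~R =
  3 ^+ t * (E%:~R + (a%:~R - b%:~R) * (a%:~R + b%:~R + 1) * (16 * (2 ^+ k) ^+ 2 - 1) / 6)
  + (3 ^+ t * 3 ^+ t - 3 ^+ t) / 2 * (2 ^+ k) ^+ 2
    * ((2 * a%:~R + 1) ^+ 2 - (2 * b%:~R + 1) ^+ 2) :> rat.
Proof.
have htri x : (tri x)%:~R = x%:~R * (x%:~R + 1) / 2 :> rat.
  have := congr1 (fun z : int => z%:~R : rat) (double_tri x).
  by rewrite !intrM intrD => h; lra.
have hd : (double_excess k)%:~R = 2 * ((2 ^+ k) ^+ 2 - 1) / 3 :> rat.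
  have := congr1 (fun z : int => z%:~R : rat) (double_excessE k).
  rewrite -[4]/(2 ^+ 2 : int) exprAC !intrM intrB !rmorphXn /= => h; lra.
have ht : (triple_excess t)%:~R = (3 ^+ t * 3 ^+ t - 3 ^+ t) / 2 :> rat.
  have := congr1 (fun z : int => z%:~R : rat) (triple_excessE t).
  by rewrite !intrM intrB intrM !rmorphXn /= => h; lra.
rewrite /iterated_exp; have := htri a; have := htri b.
move: (tri a) (tri b) (double_excess k) (triple_excess t) hd ht => x y d h hd ht hy hx.
rewrite !(intrB, intrD, intrM) !rmorphXn /= hx hy hd ht.
by field.
Qed.

End Exponents.

Theorem theorem2p6 (L t p p' n : nat) (r s : int) :
  (0 < p)%N -> (p < p')%N -> (2 <= n)%N ->
  0 < r -> r < p%:Z -> 0 < s -> s < p'%:Z ->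
  let T : int := 3 ^+ t in
  let Tq : rat := 3 ^+ t in
  let rq : rat := r%:~R in
  Dnonneg (T * 2 ^+ n * p'%:Z) (T * 2 ^+ n * s)
    (L%:Z + T * 2 ^+ (n - 2) + T * 2 ^+ (n - 1) * (r - s))
    (L%:Z - T * 2 ^+ (n - 2) - T * 2 ^+ (n - 1) * (r - s))
    (((2 ^+ (2 * n) - 1) / 3 * (2 * p'%:R - 1) - (2 ^+ (2 * n + 1) + 1) / 3 * rq
        + p%:R) / 2 ^+ n
      - (Tq - 1) * 2 ^+ (n - 2) + (Tq - 1) * 2 ^+ (n - 1) * (p'%:R - rq))
    (((2 ^+ (2 * n + 1) + 1) / 3 * rq + (2 ^+ (2 * n) - 1) / 3) / 2 ^+ n
      + (Tq - 1) * 2 ^+ (n - 2) + (Tq - 1) * 2 ^+ (n - 1) * rq).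
Proof.
move=> p0 pp' n2 r0 rp s0 sp' T Tq rq e.
(* [k] doublings follow the even transformation inside [hook_family_central], making [n - 1] uses in
   all. *)
have [k ek] : exists k, n = k.+2 by exists (n - 2)%N; lia.
have e2n : 2 ^+ (2 * k.+2) = 16 * (2 ^+ k) ^+ 2 :> rat.
  by rewrite mulnC exprM !exprS; ring.
have e2n1 : 2 ^+ (2 * k.+2 + 1) = 32 * (2 ^+ k) ^+ 2 :> rat.
  by rewrite addn1 exprS e2n; ring.
have pow2 (R : comPzRingType) : (2 ^+ k.+2 = 4 * 2 ^+ k :> R) * (2 ^+ k.+1 = 2 * 2 ^+ k :> R).
  by split; rewrite !exprS //; ring.
rewrite {}ek {n n2} e2n e2n1 subn2 subn1 -[k.+2.-2]/k -[k.+2.-1]/k.+1 !pow2.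
set N := L%:Z + _ + _; set M := L%:Z - _ - _.
set K := T * _ * _; set i := T * _ * s; set al := _ + (Tq - 1) * _ * (_ - _).
set be := _ + (Tq - 1) * _ * rq.
(* The fully transformed shift of the first binomial at [j = 0]. *)
pose c := 3 ^+ t * (2 ^+ k * (2 * (r - s) + 1)) : int.
have eM : M = L%:Z - c by rewrite /M /c /T; ring.
have eMN : M + N = (L + L)%N by rewrite /M /N PoszD; ring.
have T1 : 1 <= T by exact: exprn_ege1.
have U1 : 1 <= 2 ^+ k :> int by exact: exprn_ege1.
pose B := (2 * absz M + absz N + absz i + 1)%N.
rewrite /Dcoef -[jwindow _ _ _ _]/(window B).
(* [M <= |M| < B], and the factor of [B] is at least 1. *)
have MB : L%:Z - c < 3 ^+ t * (2 ^+ k * (4 * (p'%:Z * B%:Z))).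
  rewrite -eM; have : M < B by rewrite /B; lia.
  have : 1 <= T * (2 ^+ k * (4 * p'%:Z)) by nia.
  by rewrite -/T; nia.
pose E x := iterated_exp t k (hook_exp p p' r s x) (hook_shift p' r s x)
  - iterated_exp t k 0 (r - s).
pose P x := qbinom (M + N) (L%:Z - 3 ^+ t * (2 ^+ k * (2 * hook_shift p' r s x + 1))).
have u0 : 2 ^+ k != 0 :> rat by rewrite expf_neq0.
(* The rational exponents of [D] are the integers [E], and its lower indices are those of the
   iterated family. *)
rewrite (eq_bigr (fun j => shift_coef (E (false, j))%:~R (P (false, j)) e
    - shift_coef (E (true, j))%:~R (P (true, j)) e)); last first.
  move=> j _; congr (shift_coef _ (qbinom _ _) _ - shift_coef _ (qbinom _ _) _).
  - rewrite /E iterated_expE /hook_exp /hook_shift /al /be /K /i /=.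
    rewrite !(intrB, intrD, intrM) /T !rmorphXn -/Tq -/rq -!pmulrn.
    by field.
  - by rewrite eM /c /K /hook_shift /T /=; ring.
  - rewrite /E iterated_expE /hook_exp /hook_shift /al /be /K /i /=.
    rewrite !(intrB, intrD, intrM) /T !rmorphXn -/Tq -/rq -!pmulrn.
    by field.
  - by rewrite eM /c /K /i /hook_shift /T /=; ring.
suff : 0 <= \sum_(x <- hook_index B) (if x.1 then -1 else 1) * shift_coef (E x)%:~R (P x) e.
  rewrite hook_index_sum -big_split /=; congr (0 <= _); apply: eq_bigr => j _.
  by rewrite mul1r mulN1r.
apply: laurent_coef_ge0.
have X_gen := generic_Xfrac; have X_cone := laurent_cone.
have X_pos : positive_param ratfun laurent_nonneg Xfrac.
  by split=> //; [exact: laurent_Xfrac|exact: laurent_XfracV].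
have := hook_family_iterated _ _ X_cone _ _ _ _ B pp' r0 rp s0 sp' _ t k X_pos L MB.
(* A power of [q], in the cone even when negative, supplies the normalisation subtracted in [E]. *)
move/(coneM _ _ X_cone _ _ (coneXz _ _ X_cone _ (- iterated_exp t k 0 (r - s))
  laurent_Xfrac laurent_XfracV)).
move=> h; apply: (eq_ind _ laurent_nonneg h); rewrite mulr_sumr; apply: eq_bigr => x _.
have comm (f g h1 h2 : ratfun) : f * (g * h1 * h2) = g * (h1 * f) * h2 by ring.
rewrite /P eMN qbinom_tofrac comm; congr (_ * _ * _).
exact/esym/(expzD _ _ X_gen).
Qed.
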